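(* Let $n\ge1$ be an integer and let $X$ be a simplicial complex. If the barycentric subdivision of $X$ is combinatorially $n$-essential, then $|V(X)|\ge \frac{(n+1)(n+2)}{2}$.
   Context: For a simplicial complex $K$, $V(K)$ denotes its vertex set. For $W\subset V(K)$, $\langle W\rangle$ denotes the induced subcomplex, consisting of all faces of $K$ whose vertices all lie in $W$. A subset $Y\subset V(K)$ is called inessential if for every connected component $C$ of $\langle Y\rangle$, with $D$ the connected component of $K$ containing $C$, the natural map $\pi_1(C)\to\pi_1(D)$ is trivial. The complex $K$ is called combinatorially $n$-essential if $V(K)$ cannot be partitioned into $n$ or fewer inessential sets. *)

(* Defs.v *)
From HB Require Import structures.
From mathcomp Require Import all_boot all_order all_algebra finmap.
From mathcomp Require Import all_classical all_reals all_analysis.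
From Stdlib Require Import Relation_Operators.
Import Order.TTheory GRing.Theory Num.Theory.
Import numFieldNormedType.Exports.

Set Implicit Arguments.
Unset Strict Implicit.
Unset Printing Implicit Defensive.

Local Open Scope classical_set_scope.
Local Open Scope ring_scope.

(* An abstract simplicial complex, possibly infinite, given by its nonempty
   faces. An element of T need not be a vertex of the complex. *)
Record simplicial_complex (T : choiceType) := SimplicialComplex {
  faces : set {fset T};
  faces_neq0 : forall s, faces s -> s != fset0;
  faces_sub : forall s t, faces s -> (t `<=` s)%fset -> t != fset0 -> faces t }.

Definition vertices (T : choiceType) (K : simplicial_complex T) : set T :=
  [set v | faces K [fset v]%fset].

Section Subcomplexes.
Variable T : choiceType.

Lemma induced_neq0 (K : simplicial_complex T) (W : set T) (s : {fset T}) :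
  (faces K `&` [set s | [set` s] `<=` W]) s -> s != fset0.
Proof. by case=> /faces_neq0. Qed.

Lemma induced_sub (K : simplicial_complex T) (W : set T) (s t : {fset T}) :
  (faces K `&` [set s | [set` s] `<=` W]) s -> (t `<=` s)%fset ->
  t != fset0 -> (faces K `&` [set s | [set` s] `<=` W]) t.
Proof.
case=> Ks sW ts t0; split; first exact: faces_sub Ks ts t0.
by move=> v /= vt; apply: sW; exact: (fsubsetP ts).
Qed.

Definition induced_subcomplex (K : simplicial_complex T) (W : set T) :
    simplicial_complex T :=
  SimplicialComplex (@induced_neq0 K W) (@induced_sub K W).

(* The case u = v of [adjacent] says that u is a vertex. *)
Definition adjacent (K : simplicial_complex T) (u v : T) : Prop :=
  faces K [fset u; v]%fset.

Definition reachable (K : simplicial_complex T) (u v : T) : Prop :=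
  clos_refl_trans T (adjacent K) u v.

(* The connected component of K that contains the vertex v. *)
Definition component (K : simplicial_complex T) (v : T) :
    simplicial_complex T :=
  induced_subcomplex K [set w | reachable K v w].

Lemma component_induced (K : simplicial_complex T) (W : set T) (v : T) :
  faces (component (induced_subcomplex K W) v) `<=` faces (component K v).
Proof.
move=> s [[Ks _] sr]; split=> // w /sr /=.
elim=> [a b [ab _]|a|a b c _ ab _ bc].
- exact: rt_step.
- exact: rt_refl.
- exact: rt_trans ab bc.
Qed.

End Subcomplexes.

Section BarycentricSubdivision.
Variables (T : choiceType) (K : simplicial_complex T).

Definition chains : set {fset {fset T}} :=
  [set c | [/\ c != fset0, [set` c] `<=` faces K &
    forall s t, s \in c -> t \in c -> (s `<=` t)%fset \/ (t `<=` s)%fset]].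

Lemma chains_neq0 c : chains c -> c != fset0.
Proof. by case. Qed.

Lemma chains_sub c d : chains c -> (d `<=` c)%fset -> d != fset0 -> chains d.
Proof.
case=> _ cK cc /fsubsetP dc d0; split=> //; first by move=> s /dc /cK.
by move=> s t /dc sc /dc tc; exact: cc.
Qed.

Definition barycentric : simplicial_complex {fset T} :=
  SimplicialComplex chains_neq0 chains_sub.

End BarycentricSubdivision.

(* The closed geometric simplex on s, in barycentric coordinates. It inherits
   its topology from the product topology on {ptws T -> R}, and only the
   finitely many coordinates in s matter. *)
Definition simplex (R : realType) (T : choiceType) (s : {fset T}) :
    set {ptws T -> R} :=
  [set x | [/\ forall v, 0 <= x v, forall v, v \notin s -> x v = 0 &
    \sum_(v <- s) x v = 1]].

Record realization (R : realType) (T : choiceType)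
    (K : simplicial_complex T) := Realization {
  coord :> T -> R;
  coordP : exists2 s, faces K s & simplex s coord }.

HB.instance Definition _ (R : realType) (T : choiceType)
    (K : simplicial_complex T) := gen_eqMixin (realization R K).
HB.instance Definition _ (R : realType) (T : choiceType)
    (K : simplicial_complex T) := gen_choiceMixin (realization R K).

Definition simplex_incl (R : realType) (T : choiceType)
    (K : simplicial_complex T) (s : {fset T}) (Ks : faces K s)
    (x : simplex (R := R) s) : realization R K :=
  Realization (ex_intro2 _ _ s Ks (set_valP x)).

(* The weak topology of the realization: a set is open if and only if its
   trace on every closed simplex is open in that simplex. *)
Section RealizationTopology.
Variables (R : realType) (T : choiceType) (K : simplicial_complex T).

Definition realization_open : set_system (realization R K) :=
  [set U | forall s (Ks : faces K s), open (simplex_incl (R := R) Ks @^-1` U)].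

Lemma realization_openT : realization_open setT.
Proof. by move=> s Ks; rewrite preimage_setT; exact: openT. Qed.

Lemma realization_openI : setI_closed realization_open.
Proof.
by move=> A B oA oB s Ks; rewrite preimage_setI; apply: openI;
  [exact: oA|exact: oB].
Qed.

Lemma realization_open_bigU (I : Type) (f : I -> set (realization R K)) :
  (forall i, realization_open (f i)) -> realization_open (\bigcup_i f i).
Proof.
move=> of_ s Ks; rewrite preimage_bigcup; apply: bigcup_open => i _.
exact: of_.
Qed.

HB.instance Definition _ := isOpenTopological.Build (realization R K)
  realization_openT realization_openI realization_open_bigU.

Lemma realization_openE (U : set (realization R K)) :
  open U = realization_open U.
Proof. by []. Qed.

End RealizationTopology.

Section RealizationInclusion.
Variables (R : realType) (T : choiceType) (C D : simplicial_complex T).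
Variable CD : faces C `<=` faces D.

Lemma realization_incl_subproof (x : realization R C) :
  exists2 s, faces D s & simplex s (coord x).
Proof. by have [s Cs xs] := coordP x; exists s => //; exact: CD. Qed.

Definition realization_incl (x : realization R C) : realization R D :=
  Realization (realization_incl_subproof x).

Lemma realization_incl_continuous : continuous realization_incl.
Proof.
apply/continuousP => U; rewrite !realization_openE => oU s Cs.
rewrite -comp_preimage.
suff -> : realization_incl \o simplex_incl Cs = simplex_incl (CD Cs).
  exact: oU.
by apply/funext => x; congr Realization; exact: Prop_irrelevance.
Qed.

End RealizationInclusion.

Section FundamentalGroup.
Variable R : realType.
Local Notation I01 := (`[0, 1]%classic : set R).

Definition is_loop (X : topologicalType) (x : X) (g : R -> X) : Prop :=
  [/\ {within I01, continuous g}, g 0 = x & g 1 = x].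

(* Homotopy of paths relative to the endpoints. *)
Definition path_homotopic (X : topologicalType) (g h : R -> X) : Prop :=
  exists H : R * R -> X,
    [/\ {within I01 `*` I01, continuous H},
        forall s, I01 s -> H (s, 0) = g s /\ H (s, 1) = h s &
        forall t, I01 t -> H (0, t) = g 0 /\ H (1, t) = g 1].

(* The homomorphism from pi_1(X, x) to pi_1(Y, f x) induced by f is trivial for
   every base point x: it maps the class of each loop to the class of the
   constant loop. *)
Definition pi1_map_trivial (X Y : topologicalType) (f : X -> Y) : Prop :=
  forall (x : X) (g : R -> X),
    is_loop x g -> path_homotopic (f \o g) (cst (f x)).

End FundamentalGroup.

(* Each component of the induced subcomplex on Y is the component of some
   vertex v, and then the component of K containing it is that of v. *)
Definition inessential (R : realType) (T : choiceType)
    (K : simplicial_complex T) (Y : set T) : Prop :=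
  Y `<=` vertices K /\
  forall v, vertices (induced_subcomplex K Y) v ->
    pi1_map_trivial R
      (realization_incl (R := R) (component_induced (K := K) (W := Y) (v := v))).

Definition combinatorially_essential (R : realType) (T : choiceType) (n : nat)
    (K : simplicial_complex T) : Prop :=
  ~ exists (m : nat) (F : nat -> set T),
      [/\ (m <= n)%N, partition `I_m F (vertices K) &
          forall i, `I_m i -> inessential R K (F i)].

(* Main.v *)
Require Import Defs.
From mathcomp Require Import all_boot all_order all_algebra finmap.
From mathcomp Require Import lra zify.
From Stdlib Require Import Relation_Operators.
From mathcomp Require Import all_classical all_reals all_analysis.

(** The contrapositive is proved: if [X] has fewer than [(n+1)(n+2)/2] vertices,
    the faces of [X], which are the vertices of its barycentric subdivision, can
    be coloured with [n] colours so that every colour class is inessential.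

    The proof is by induction on [n] ([colouring_exists]); for [n = 0] there are
    no faces. For [n+1], suppose first that some face [S] has at least [n+2]
    vertices. Deleting the vertices of [S] leaves fewer than
    [(n+2)(n+3)/2 - (n+2) = (n+1)(n+2)/2] vertices, so the faces disjoint from
    [S] can be coloured with [n] colours. A colour class that is inessential in
    the subdivision of the smaller complex stays inessential in that of [X]
    ([inessential_sub]), and one more colour suffices for the faces that meet
    [S] ([inessential_star]). If there is no such face [S], every face has at
    most [n+1] vertices and can be coloured by its size: two distinct faces of equal
    size are incomparable, so each colour class spans a discrete subcomplex
    ([inessential_discrete]).

    The geometric point is [inessential_star]. The faces meeting [S] contract
    inside the subdivision along [a], [a `&` S], [S]: for [a] meeting [S] the
    intersection is a face of [X] contained in both [a] and [S]. The straight
    lines from [a] to [a `&` S] for all [a] in a chain cannot be run through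
    simultaneously, because [a1 `<=` a2] does not make [a1] and [a2 `&` S]
    comparable. They are therefore staggered by the size of [a]: going to
    [a `&` S] the small faces move first, going on to [S] the large ones do.
    Then the faces involved at each moment form a chain
    ([slide_supp_comparable]), and extending linearly over every simplex gives a
    free contraction of loops ([linear_contraction]), which is turned into one
    relative to the endpoints ([free_null_homotopy]). All complexes
    involved are finite, so a map into a realization is continuous as soon as its
    barycentric coordinates are ([continuous_to_realization]). *)

Import Order.TTheory GRing.Theory Num.Theory.
Import numFieldNormedType.Exports.
Set Implicit Arguments.
Unset Strict Implicit.
Unset Printing Implicit Defensive.
Local Open Scope classical_set_scope.
Local Open Scope ring_scope.

(** * Coordinates on the realization of a complex *)

Section Realization.
Variables (R : realType) (T : choiceType).
Implicit Types (K : simplicial_complex T) (s : {fset T}) (x : T -> R).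

Lemma simplex_sub s u x : (s `<=` u)%fset -> simplex s x -> simplex u x.
Proof.
move=> su [x0 xs x1]; split=> // [v vu|].
  by apply: xs; apply: contra vu; exact: (fsubsetP su).
rewrite -x1; apply/esym/big_fset_incl => // v _; exact: xs.
Qed.

Lemma realization_eq K (x y : realization R K) : x =1 y -> x = y.
Proof.
case: x y => [x xP] [y yP] /= /funext xy; move: xP yP; rewrite xy => xP yP.
by congr Realization; exact: Prop_irrelevance.
Qed.

Lemma coordinate_continuous (v : T) :
  continuous (fun x : {ptws T -> R} => x v).
Proof. exact: (@proj_continuous _ (fun=> R) v). Qed.

(** For every complex, finite or not: the weak topology is finer than the
    topology of the coordinates. *)
Lemma realization_coordinate_continuous K (v : T) :
  continuous (fun x : realization R K => x v).
Proof.
apply/continuousP => U oU; rewrite realization_openE => s Ks.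
have /continuousP : continuous
    ((fun x : {ptws T -> R} => x v) \o (set_val : simplex (R := R) s -> _)).
  move=> x; apply: continuous_comp; first exact: initial_continuous.
  exact: coordinate_continuous.
exact.
Qed.

Lemma ptws_continuous (Z : topologicalType) (f : Z -> {ptws T -> R}) :
  (forall v, continuous (fun z => f z v)) -> continuous f.
Proof.
move=> fc z; apply/cvg_sup => v; move: z.
apply/(@continuousP _ (initial_topology (@^~ v))) => _ [B oB <-].
by have /continuousP := fc v; exact.
Qed.

Lemma closed_simplex s : closed (simplex (R := R) s : set {ptws T -> R}).
Proof.
have -> : simplex s =
    \bigcap_v [set x : {ptws T -> R} | 0 <= x v] `&`
    \bigcap_(v in [set v | v \notin s]) [set x : {ptws T -> R} | x v = 0] `&`
    [set x : {ptws T -> R} | \sum_(v <- s) x v = 1].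
  apply/seteqP; split => [x [x0 xs x1]|x [[x0 xs] x1]].
    by split; [split=> [v _|v vs]; [exact: x0|exact: xs]|].
  by split=> [v|v vs|//]; [exact: x0|exact: xs].
apply: closedI; first apply: closedI.
- apply: closed_bigI => v _.
  have /continuous_closedP/(_ _ (@closed_ge R 0)) := @coordinate_continuous v.
  exact.
- apply: closed_bigI => v _.
  have /continuous_closedP/(_ _ (@closed_eq R 0)) := @coordinate_continuous v.
  exact.
- have /continuous_closedP/(_ _ (@closed_eq R 1)) : continuous
      (fun x : {ptws T -> R} => \sum_(v <- s) x v).
    apply: continuous_big => [|v _]; first exact: add_continuous.
    exact: coordinate_continuous.
  exact.
Qed.

(** For a finite complex the weak topology is the topology of the coordinates: a
    closed set is the union of its traces on the finitely many closed simplices,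
    and each trace is closed in the product space since simplices are. *)
Lemma continuous_to_realization (Z : topologicalType) K
    (f : Z -> realization R K) : finite_set (faces K) ->
  (forall v, continuous (fun z => f z v)) -> continuous f.
Proof.
move=> finK fc; pose cf z : {ptws T -> R} := f z : T -> R.
have cfc : continuous cf by exact: ptws_continuous.
apply/continuous_closedP => A; rewrite -openC realization_openE => oA.
have /cid2[C Cclosed AC] : exists2 C : {fset T} -> set {ptws T -> R},
    forall s, closed (C s) &
    forall s (Ks : faces K s) (x : simplex (R := R) s),
      A (simplex_incl Ks x) <-> C s (set_val x).
  have AC s : exists C : set {ptws T -> R}, closed C /\
      forall (Ks : faces K s) (x : simplex (R := R) s),
      A (simplex_incl Ks x) <-> C (set_val x).
    have [Ks|nKs] := pselect (faces K s); last first.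
      by exists set0; split=> [|Ks]; [exact: closed0|case: (nKs Ks)].
    have [U oU UA] := oA s Ks; exists (~` U); split; first exact: open_closedC.
    move=> Ks' x; rewrite (Prop_irrelevance Ks' Ks).
    have : (~` A) (simplex_incl Ks x) = U (set_val x).
      by rewrite -[LHS]/((_ @^-1` _) x) -UA.
    by rewrite /setC /= => <-; split=> [Ax nAx//|/contrapT].
  exists (fun s => projT1 (cid (AC s))) => s; first by case: cid => ? [].
  by case: cid => ? [].
have -> : f @^-1` A = \bigcup_(s in faces K) (cf @^-1` (C s `&` simplex s)).
  apply/seteqP; split=> z /=.
    move=> Afz; have [s Ks xs] := coordP (f z); exists s => //; split=> //.
    have := AC s Ks (SigSub (mem_set xs)); rewrite set_valE /=.
    by case=> + _; apply; congr (A _): Afz; exact: realization_eq.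
  move=> [s Ks [Cz xs]]; have := AC s Ks (SigSub (mem_set xs)).
  rewrite set_valE /= => -[_ /(_ Cz)]; congr (A _); exact: realization_eq.
apply: closed_bigcup => // s Ks; apply: preimage_closed.
  by move=> z _; exact: cfc.
by apply: closedI; [exact: Cclosed|exact: closed_simplex].
Qed.

End Realization.

(** * From free to based null-homotopies *)

Section PathHomotopy.
Variable R : realType.

Definition clamp (s : R) : R := Num.max 0 (Num.min 1 s).

Lemma clamp_ge0 s : 0 <= clamp s. Proof. by rewrite le_max lexx. Qed.
Lemma clamp_le1 s : clamp s <= 1.
Proof. by rewrite ge_max ler01 ge_min lexx. Qed.
Lemma clamp_id s : 0 <= s <= 1 -> clamp s = s.
Proof. by case/andP=> s0 s1; rewrite /clamp min_r // max_r. Qed.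
Lemma clamp_eq0 s : s <= 0 -> clamp s = 0.
Proof. by move=> s0; rewrite /clamp min_r ?max_l //; lra. Qed.
Lemma clamp_eq1 s : 1 <= s -> clamp s = 1.
Proof. by move=> s1; rewrite /clamp min_l ?max_r. Qed.
Lemma clamp_continuous : continuous clamp.
Proof.
move=> s; apply: continuous_max; first exact: cst_continuous.
by apply: continuous_min; [exact: cst_continuous|exact: cvg_id].
Qed.

Lemma continuous_clamp (Z : topologicalType) (f : Z -> R) :
  continuous f -> continuous (fun z => clamp (f z)).
Proof.
by move=> fc z; apply: (continuous_comp (fc z)); exact: clamp_continuous.
Qed.

Lemma continuous_comp_within (Z Y X : topologicalType) (A : set Y)
    (F : Z -> Y) (G : Y -> X) :
  continuous F -> (forall z, A (F z)) -> {within A, continuous G} ->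
  continuous (G \o F).
Proof.
move=> Fc FA /subspace_continuousP Gc z.
apply: cvg_comp (Gc _ (FA z)) => U; rewrite withinE => -[V /Fc VF UV].
apply: (@filterS _ (nbhs z) _ (F @^-1` V)) VF => w Vw.
have : (V `&` A) (F w) by [].
by rewrite -UV => -[].
Qed.

(** The base point runs through the path [r |-> G (0, r)] to [c] during the free
    contraction [G]. The based homotopy goes in its first half from [g] to this
    path followed by its inverse, and in its second half shrinks that detour. *)
Lemma free_null_homotopy (Z : topologicalType) (g : R -> Z) (c : Z)
    (G : R * R -> Z) : continuous G ->
  (forall s, 0 <= s <= 1 -> G (s, 0) = g s) -> (forall s, G (s, 1) = c) ->
  (forall t, G (0, t) = G (1, t)) ->
  path_homotopic g (cst (g 0)).
Proof.
move=> Gc Gg G1 Gloop.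
(* [tent] climbs from 0 to 1 on the first third of the unit interval and
   descends on the last one. In [H1] the loop is squeezed into the middle third
   while the two outer thirds follow the track of the base point. *)
pose tent (s : R) := clamp (Num.min (3 * s) (3 - 3 * s)).
pose H1 (p : R * R) :=
  G (clamp ((1 + 4 * p.2) * p.1 - 2 * p.2), 2 * p.2 * tent p.1).
pose H2 (p : R * R) := G (0, (2 - 2 * p.2) * tent p.1).
pose H (p : R * R) := if p.2 <= 2^-1 then H1 p else H2 p.
have fstc : continuous (fun p : R * R => p.1) by move=> p; exact: cvg_fst.
have sndc : continuous (fun p : R * R => p.2) by move=> p; exact: cvg_snd.
have cc (a : R) : continuous (fun p : R * R => a) by move=> p; exact: cvg_cst.
have tc : continuous (fun p : R * R => tent p.1).
  apply: continuous_clamp => p.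
  apply: (@continuous_min R (R * R)%type
    (fun p => 3 * p.1) (fun p => 3 - 3 * p.1)).
    by apply: cvgM; [exact: cc|exact: fstc].
  by apply: cvgB; [exact: cc|apply: cvgM; [exact: cc|exact: fstc]].
have GcP (a b : R * R -> R) : continuous a -> continuous b ->
    continuous (fun p => G (a p, b p)).
  move=> ac bc p; have abc : {for p, continuous (fun p => (a p, b p))}.
    exact: cvg_pair (ac p) (bc p).
  exact: (continuous_comp abc (@Gc _)).
have H1c : continuous H1.
  apply: GcP => [|p].
    apply: continuous_clamp => p; apply: cvgB; last first.
      by apply: cvgM; [exact: cc|exact: sndc].
    apply: cvgM; last exact: fstc.
    by apply: cvgD; [exact: cc|apply: cvgM; [exact: cc|exact: sndc]].
  apply: cvgM; last exact: tc.
  by apply: cvgM; [exact: cc|exact: sndc].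
have H2c : continuous H2.
  apply: GcP => [|p]; first exact: cc.
  apply: cvgM; last exact: tc.
  by apply: cvgB; [exact: cc|apply: cvgM; [exact: cc|exact: sndc]].
(* At time 1/2, on the outer thirds the first argument of [G] is an endpoint,
   and both endpoints have the same track; on the middle third [tent s = 1],
   where [G] is the constant [c]. *)
have H12 s : H1 (s, 2^-1) = H2 (s, 2^-1).
  rewrite /H1 /H2 /= (_ : 2 * 2^-1 = 1); last by lra.
  rewrite (_ : 2 - 1 = 1); last by lra.
  rewrite !mul1r (_ : (1 + 4 * 2^-1) * s - 1 = 3 * s - 1); last by lra.
  have [s1|s1] := leP s 3^-1; first by rewrite clamp_eq0 //; lra.
  have [s2|s2] := leP (2 * 3^-1) s.
    by rewrite clamp_eq1 -?Gloop //; lra.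
  suff -> : tent s = 1 by rewrite !G1.
  by apply: clamp_eq1; rewrite le_min; lra.
exists H; split.
- apply: continuous_subspaceT; rewrite continuous_subspace_setT.
  have -> : [set: R * R] = [set p | p.2 <= 2^-1] `|` [set p | 2^-1 <= p.2].
    apply/seteqP; split=> // p _.
    by case: (leP p.2 2^-1) => [|/ltW]; [left|right].
  apply: withinU_continuous.
  + by have /continuous_closedP/(_ _ (@closed_le R 2^-1)) := sndc.
  + by have /continuous_closedP/(_ _ (@closed_ge R 2^-1)) := sndc.
  + apply: (@subspace_eq_continuous _ _ _ H1); last exact: continuous_subspaceT.
    by move=> p; rewrite inE /= /from_subspace /H => ->.
  + apply: (@subspace_eq_continuous _ _ _ H2); last exact: continuous_subspaceT.
    move=> [s t]; rewrite inE /= /from_subspace /H /= => t2.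
    case: ifP => // t2'; have -> : t = 2^-1 by apply/le_anti/andP.
    by rewrite H12.
- move=> s; rewrite /= in_itv /= => s01; split.
    rewrite /H /= ifT; last by lra.
    by rewrite /H1 /= !mulr0 mul0r addr0 mul1r subr0 clamp_id // Gg.
  rewrite /H /= ifF; last by apply/negP; lra.
  by rewrite /H2 /= mulr1 subrr mul0r Gg // lexx ler01.
- move=> t; rewrite /= in_itv /= => t01.
  have g01 : G (0, 0) = g 0 by rewrite Gg // lexx ler01.
  have t0 : tent 0 = 0 by apply: clamp_eq0; rewrite ge_min; lra.
  have t1 : tent 1 = 0 by apply: clamp_eq0; rewrite ge_min; lra.
  have gg : g 1 = g 0 by rewrite -Gg ?lexx ?ler01 // -Gloop.
  rewrite /H /H1 /H2 /= t0 t1 !mulr0 mulr1 clamp_eq0; last by lra.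
  rewrite clamp_eq1; last by lra.
  by rewrite -Gloop g01 gg; case: ifP.
Qed.

End PathHomotopy.

(** * Contractions that are linear on simplices *)

Section LinearHomotopy.
Variables (R : realType) (T : choiceType).
Implicit Types (C D : simplicial_complex T) (s : {fset T}).

Lemma simplex_mix c (x : T -> R) (A : T -> {fset T}) (P : T -> T -> R) :
  simplex c x -> (forall a, a \in c -> simplex (A a) (P a)) ->
  simplex (\bigcup_(a <- c) A a)%fset
    ((fun b => \sum_(a <- c) x a * P a b) : T -> R).
Proof.
set U := (\bigcup_(a <- c) A a)%fset => -[x0 _ x1] AP.
have PU a : a \in c -> simplex U (P a).
  by move=> ac; apply: simplex_sub (AP _ ac); exact: bigfcup_sup.
split=> [b|b bU|].
- rewrite big_seq sumr_ge0 // => a ac; have [P0 _ _] := PU a ac.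
  exact: mulr_ge0.
- rewrite big_seq big1 // => a ac; have [_ /(_ _ bU) -> _] := PU a ac.
  exact: mulr0.
- rewrite exchange_big /= -x1 big_seq [RHS]big_seq; apply: eq_bigr => a ac.
  by have [_ _ P1] := PU a ac; rewrite -mulr_sumr P1 mulr1.
Qed.

(** A point of a simplex of [C] is a convex combination of vertices; it is moved
    by letting each vertex [a] run along the path [t |-> P t a] with the weights
    kept fixed. The condition on [A] says that the vertices of a simplex stay in
    a common simplex of [D] at every time, so that the moving point never leaves
    the realization of [D]. All points end in [o], which makes loops freely,
    hence also based, null-homotopic in [D]. *)
Lemma linear_contraction C D (CD : faces C `<=` faces D) (V : {fset T}) (o : T)
    (A : R -> T -> {fset T}) (P : R -> T -> T -> R) :
  finite_set (faces D) -> (forall c, faces C c -> (c `<=` V)%fset) ->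
  (forall t c a, faces C c -> a \in c -> simplex (A t a) (P t a)) ->
  (forall t c, faces C c -> faces D (\bigcup_(a <- c) A t a)%fset) ->
  (forall a b, continuous (fun t => P t a b)) ->
  (forall a b, a \in V -> P 0 a b = (b == a)%:R) ->
  (forall a b, a \in V -> P 1 a b = (b == o)%:R) ->
  pi1_map_trivial R (realization_incl (R := R) CD).
Proof.
move=> finD CV AP AD Pc P0 P1 x g [gc g0 g1].
pose mix t (y : realization R C) : T -> R :=
  fun b => \sum_(a <- V) y a * P t a b.
have mixP t y : exists2 s, faces D s & simplex s (mix t y).
  have [c Cc yc] := coordP y.
  exists (\bigcup_(a <- c) A t a)%fset; first exact: AD.
  rewrite /mix (_ : (fun b => _) = fun b => \sum_(a <- c) y a * P t a b).
    apply: simplex_mix => // a ac; exact: AP ac.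
  apply/funext => b; apply/esym/big_fset_incl; first exact: CV.
  by move=> a _ ac; case: yc => _ /(_ _ ac) -> _; rewrite mul0r.
(* A loop is only continuous on the unit interval; composed with [clamp] it is
   continuous on the whole line and unchanged on the interval. *)
pose G (p : R * R) : realization R D := Realization (mixP p.2 (g (clamp p.1))).
have g'c : continuous (g \o clamp (R := R)).
  apply: continuous_comp_within gc; first exact: clamp_continuous.
  by move=> z; rewrite /= in_itv /= clamp_ge0 clamp_le1.
have Gc : continuous G.
  apply: continuous_to_realization => // b.
  apply: continuous_big => [|a _]; first exact: add_continuous.
  move=> p; apply: cvgM.
    have pc : {for p, continuous (fun p : R * R => p.1)} by exact: cvg_fst.
    have := continuous_comp pc (@g'c _).
    move=> /continuous_comp/(_ (@realization_coordinate_continuous _ _ _ a _)).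
    exact.
  have pc : {for p, continuous (fun p : R * R => p.2)} by exact: cvg_snd.
  exact: (continuous_comp pc (@Pc a b _)).
have G0 (s : R) : 0 <= s <= 1 -> G (s, 0) = realization_incl CD (g s).
  move=> s01; apply: realization_eq => b /=; rewrite /mix /= clamp_id //.
  have [c Cc [_ y0 _]] := coordP (g s).
  have [bV|bV] := boolP (b \in V).
    rewrite (big_fsetD1 b) //= P0 // eqxx mulr1 big_seq big1 ?addr0 // => a.
    by rewrite !inE => /andP[ab aV]; rewrite P0 // eq_sym (negbTE ab) mulr0.
  rewrite y0; last by apply: contra bV; exact/fsubsetP/CV.
  rewrite big_seq big1 // => a aV; rewrite P0 //; case: eqVneq => [ba|_].
    by rewrite ba aV in bV.
  by rewrite mulr0.
have G1 (s : R) : G (s, 1) = G (0, 1).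
  have G1b (r : R) b : G (r, 1) b = (b == o)%:R.
    rewrite /= /mix /=; set y := g _; have [c Cc [_ y0 y1]] := coordP y.
    transitivity ((\sum_(a <- c) y a) * (b == o)%:R); last by rewrite y1 mul1r.
    rewrite mulr_suml [RHS](big_fset_incl _ (CV _ Cc)); last first.
      by move=> a _ /y0 ->; rewrite mul0r.
    by rewrite big_seq [RHS]big_seq; apply: eq_bigr => a aV; rewrite P1.
  by apply: realization_eq => b; rewrite !G1b.
have -> : cst (realization_incl CD x) =
    cst ((realization_incl CD \o g) 0) :> (R -> _) by rewrite /= g0.
apply: (free_null_homotopy Gc) G1 _ => // t.
apply: realization_eq => b; rewrite /= /mix /=.
by rewrite !clamp_id ?lexx ?ler01 // g0 g1.
Qed.

End LinearHomotopy.

(** * Comparable faces in the barycentric subdivision *)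

Section Barycentric.
Variables (T : choiceType) (X : simplicial_complex T).
Implicit Types (s t : {fset T}) (c : {fset {fset T}}).

Lemma vertices_barycentric : vertices (barycentric X) = faces X.
Proof.
apply/seteqP; split=> s; rewrite /vertices /=.
  by case=> _ + _; apply; rewrite /= inE.
move=> Xs; split; first by apply/fset0Pn; exists s; rewrite inE.
  by move=> t /=; rewrite inE => /eqP ->.
by move=> t u; rewrite !inE => /eqP -> /eqP ->; left.
Qed.

Lemma adjacent_barycentric s t : faces X s -> faces X t -> (s `<=` t)%fset ->
  Defs.adjacent (barycentric X) s t /\ Defs.adjacent (barycentric X) t s.
Proof.
move=> Xs Xt st; suff st1 : Defs.adjacent (barycentric X) s t.
  by split=> //; rewrite /Defs.adjacent fsetUC.
split; first by apply/fset0Pn; exists s; rewrite !inE eqxx.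
  by move=> u; rewrite /= !inE => /orP[]/eqP ->.
by move=> u w; rewrite !inE => /orP[]/eqP -> /orP[]/eqP ->; auto.
Qed.

End Barycentric.

(** * The faces meeting a given face *)

Lemma natr_doubleS (R : realType) (N : nat) :
  N.*2.+1%:R = 2 * N%:R + 1 :> R.
Proof. by rewrite -natr1 -muln2 natrM mulrC. Qed.

Section Slide.
Variables (R : realType) (T : choiceType) (S : {fset T}) (N : nat).
Implicit Types (s a b : {fset T}) (t : R).

(** The position at time [t] of the point starting at the vertex [a] and moving
    along [a], [a `&` S], [S]. With [N] bounding the sizes, the first move takes
    place between the times [#|` a|] and [#|` a| + 1], hence is over at time
    [N + 1] for all [a]; the second one takes place between [2N + 1 - #|` a|]
    and [2N + 2 - #|` a|], hence not before time [N + 1]. *)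
Definition slide t a b : R :=
  let lam := clamp (t - #|` a|%:R) in
  let mu := clamp (t + #|` a|%:R - N.*2.+1%:R) in
  (1 - lam) * (b == a)%:R + (lam - mu) * (b == a `&` S)%fset%:R +
  mu * (b == S)%:R.

(** Faces of weight zero are left out: all three faces on the path of [a], taken
    for every [a] of a chain, need not form a chain. *)
Definition slide_supp t a : {fset {fset T}} :=
  [fset b in [fset a; a `&` S; S] | slide t a b != 0]%fset.

Lemma in_slide_supp t a b : (b \in slide_supp t a) =
  (b \in [fset a; a `&` S; S]%fset) && (slide t a b != 0).
Proof. by rewrite !inE. Qed.

Lemma le_clamp (x y : R) : x <= y -> clamp x <= clamp y.
Proof.
move=> xy; rewrite /clamp ge_max !le_max lexx /=; apply/orP; right.
by rewrite le_min !ge_min lexx xy orbT.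
Qed.

Lemma slide_simplex t a : (#|` a| <= N)%N ->
  simplex (slide_supp t a) (slide t a).
Proof.
move=> aN; have aNR : #|` a|%:R <= N%:R :> R by rewrite ler_nat.
have NE := natr_doubleS R N.
set u := [fset a; a `&` S; S]%fset.
suff [s0 su s1] : simplex u (slide t a).
  split=> // [b|].
    by rewrite in_slide_supp negb_and negbK => /orP[/su|/eqP].
  rewrite -s1; apply: big_fset_incl => [|b bu].
    by apply/fsubsetP => b; rewrite in_slide_supp => /andP[].
  by rewrite in_slide_supp bu negbK => /eqP.
have mulam : clamp (t + #|` a|%:R - N.*2.+1%:R) <= clamp (t - #|` a|%:R).
  by apply: le_clamp; rewrite NE; lra.
split=> [b|b|].
- rewrite /slide; apply: addr_ge0; first apply: addr_ge0.
  + by rewrite mulr_ge0 ?ler0n // subr_ge0 clamp_le1.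
  + by rewrite mulr_ge0 ?ler0n // subr_ge0.
  + by rewrite mulr_ge0 ?ler0n // clamp_ge0.
- rewrite !inE !negb_or => /andP[/andP[/negbTE ba /negbTE bS] /negbTE bs].
  by rewrite /slide ba bS bs !mulr0 !addr0.
- have delta v : v \in u -> \sum_(b <- u) (b == v)%:R = 1 :> R.
    move=> vu; rewrite (big_fsetD1 v) //= eqxx big_seq big1 ?addr0 // => b.
    by rewrite !inE => /andP[/negbTE ->].
  rewrite /slide !big_split /= -!mulr_sumr !delta ?inE ?eqxx ?orbT // !mulr1.
  by rewrite subrKA subrK.
Qed.

Lemma slide_suppP t a b : (#|` a| <= N)%N -> b \in slide_supp t a ->
  [\/ b = a /\ t < #|` a|%:R + 1, b = (a `&` S)%fset /\ #|` a|%:R < t |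
      b = S /\ N.*2.+1%:R - #|` a|%:R < t].
Proof.
move=> aN; have aNR : #|` a|%:R <= N%:R :> R by rewrite ler_nat.
have NE := natr_doubleS R N.
rewrite in_slide_supp => /andP[_]; rewrite /slide.
set k := #|` a|%:R; set lam := clamp (t - k); set mu := clamp _.
have [/andP[/eqP -> ?] _|/nandP n1] := boolP ((b == a) && (t < k + 1)).
  exact: Or31.
have [/andP[/eqP -> ?] _|/nandP n2] := boolP ((b == a `&` S)%fset && (k < t)).
  exact: Or32.
have [/andP[/eqP -> ?] _|/nandP n3] :=
  boolP ((b == S) && (N.*2.+1%:R - k < t)).
  exact: Or33.
case/eqP.
have -> : (1 - lam) * (b == a)%:R = 0.
  case: n1 => [/negbTE ->|]; first by rewrite mulr0.
  by rewrite -leNgt => kt; rewrite /lam clamp_eq1 ?subrr ?mul0r //; lra.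
have mu0 : mu * (b == S)%:R = 0.
  case: n3 => [/negbTE ->|]; first by rewrite mulr0.
  by rewrite -leNgt => kt; rewrite /mu clamp_eq0 ?mul0r //; lra.
rewrite mu0 add0r addr0.
case: n2 => [/negbTE ->|]; first by rewrite mulr0.
rewrite -leNgt => kt.
by rewrite /lam /mu !clamp_eq0 ?subrr ?mul0r // ?NE /k; lra.
Qed.

End Slide.

Section Star.
Variables (R : realType) (T : choiceType) (X : simplicial_complex T).
Implicit Types (s a b : {fset T}) (c : {fset {fset T}}).

(** Why the paths of comparable faces stay in a common simplex. Take
    [a1 `<=` a2]. Since [a1 `&` S] lies in everything on the path of [a2], and
    [S] contains every intersection with [S], only two pairs are in danger. One
    is [a1] with [a2 `&` S]: as small faces move first, both have positive
    weight only if [a1] and [a2] have the same size, hence are equal. The other is a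
    starting face with [S]: they never occur together, since time [N + 1]
    separates the two moves. *)
Lemma slide_supp_comparable (S : {fset T}) (N : nat) (t : R) a1 a2 b1 b2 :
  (#|` a1| <= N)%N -> (#|` a2| <= N)%N ->
  (a1 `<=` a2)%fset \/ (a2 `<=` a1)%fset ->
  b1 \in slide_supp S N t a1 -> b2 \in slide_supp S N t a2 ->
  (b1 `<=` b2)%fset \/ (b2 `<=` b1)%fset.
Proof.
wlog a12 : a1 a2 b1 b2 / (a1 `<=` a2)%fset.
  move=> wl a1N a2N a12 h1 h2; have [a12'|a21] := a12; first exact: wl h1 h2.
  by apply/or_comm; apply: wl h2 h1 => //; left.
move=> a1N a2N _ /(slide_suppP a1N) h1 /(slide_suppP a2N) h2.
have a1NR : #|` a1|%:R <= N%:R :> R by rewrite ler_nat.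
have a2NR : #|` a2|%:R <= N%:R :> R by rewrite ler_nat.
have NE := natr_doubleS R N.
case: h1 => [[-> t1]|[-> t1]|[-> t1]]; case: h2 => [[-> t2]|[-> t2]|[-> t2]].
- by left.
- have a21 : (#|` a2| <= #|` a1|)%N.
    rewrite -ltnS -(ltr_nat R) -natr1; exact: lt_trans t2 t1.
  have -> : a1 = a2 by apply/eqP; rewrite eqEfcard a12.
  by right; exact: fsubsetIl.
- by exfalso; move: NE t2 t1 a1NR a2NR; lra.
- by left; apply: fsubset_trans a12; exact: fsubsetIl.
- by left; exact: fsetSI.
- by left; exact: fsubsetIr.
- by exfalso; move: NE t2 t1 a1NR a2NR; lra.
- by right; exact: fsubsetIr.
- by left.
Qed.

Lemma finite_barycentric (V : {fset T}) :
  faces X `<=` [set s | (s `<=` V)%fset] -> finite_set (faces (barycentric X)).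
Proof.
move=> XV; apply: (@sub_finite_set _ _ [set` fpowerset (fpowerset V)]).
  move=> c [_ cX _]; rewrite /= fpowersetE; apply/fsubsetP => s /cX/XV.
  by rewrite fpowersetE.
exact: finite_fset.
Qed.

(** All faces on the path of [a] lie in the component of [a], since [a] and [S]
    are both adjacent to [a `&` S]; hence the contraction takes place in the
    component of the subdivision. *)
Lemma inessential_star (V S : {fset T}) :
  faces X `<=` [set s | (s `<=` V)%fset] -> faces X S ->
  inessential R (barycentric X) [set s | faces X s /\ (s `&` S)%fset != fset0].
Proof.
move=> XV XS; set Y := [set s | _].
split=> [|v Yv]; first by rewrite vertices_barycentric => s [].
set CD := @component_induced _ _ _ _; clearbody CD.
set C := component _ v in CD *.
have CV c a : faces C c -> a \in c ->
    [/\ Y a, (#|` a| <= #|` V|)%N & reachable (barycentric X) v a].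
  move=> Cc ac; have [_ cr] := CD _ Cc.
  have Ya : Y a by case: Cc => -[_ +] _; exact.
  split=> //; last exact: cr.
  by apply: fsubset_leq_card; apply: XV; case: Ya.
have XI a : Y a -> faces X (a `&` S)%fset.
  by case=> Xa aS; apply: faces_sub Xa _ aS; exact: fsubsetIl.
pose P (t : R) := slide S #|` V| (t * (#|` V|.*2.+2)%:R).
pose A (t : R) := slide_supp S #|` V| (t * (#|` V|.*2.+2)%:R).
apply: (@linear_contraction _ _ _ _ CD (fpowerset V) S A P).
- apply: sub_finite_set (finite_barycentric XV).
  by move=> c [].
- move=> c Cc; apply/fsubsetP => a ac; rewrite fpowersetE.
  by have [[Xa _] _ _] := CV _ _ Cc ac; exact: XV.
- by move=> t c a Cc ac; apply: slide_simplex; have [] := CV _ _ Cc ac.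
- move=> t c Cc; have cX : chains X c by case: Cc => -[].
  have bP b : b \in (\bigcup_(a <- c) A t a)%fset ->
      exists2 a, a \in c & b \in A t a.
    by case/bigfcupP => a; rewrite andbT => ac ba; exists a.
  have Abr a b : a \in c -> b \in A t a ->
      faces X b /\ reachable (barycentric X) v b.
    move=> ac /slide_suppP; have [Ya aV va] := CV _ _ Cc ac.
    have [Xa _] := Ya; have XaS := XI _ Ya.
    have vaS : reachable (barycentric X) v (a `&` S)%fset.
      apply: rt_trans va _; apply: rt_step.
      by have [] := adjacent_barycentric XaS Xa (fsubsetIl _ _).
    case/(_ aV) => -[-> _] //; split=> //.
    apply: rt_trans vaS _; apply: rt_step.
    by have [] := adjacent_barycentric XaS XS (fsubsetIr _ _).
  split; last by move=> b /bP[a ac ba]; have [] := Abr a b ac ba.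
  split.
  + have [/fset0Pn[a ac] _ _] := cX; have [_ aV _] := CV _ _ Cc ac.
    have [_ _ Pa1] := @slide_simplex R _ S _ (t * (#|` V|.*2.+2)%:R) a aV.
    have [b ba] : exists b, b \in A t a.
      apply/fset0Pn/eqP => A0; move: Pa1; rewrite -/(A t a) A0 big_seq_fset0.
      by move/eqP; rewrite eq_sym oner_eq0.
    by apply/fset0Pn; exists b; apply/bigfcupP; exists a; rewrite ?ac.
  + by move=> b /bP[a ac ba]; have [] := Abr a b ac ba.
  + move=> b1 b2 /bP[a1 ac1 ba1] /bP[a2 ac2 ba2].
    have [_ aV1 _] := CV _ _ Cc ac1; have [_ aV2 _] := CV _ _ Cc ac2.
    by apply: slide_supp_comparable ba1 ba2 => //; case: cX => _ _; exact.
- move=> a b; rewrite /P /slide.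
  have linc : continuous (fun t : R => t * (#|` V|.*2.+2)%:R).
    by move=> t; apply: cvgM; [exact: cvg_id|exact: cvg_cst].
  have lamc : continuous
      (fun t : R => clamp (t * (#|` V|.*2.+2)%:R - #|` a|%:R)).
    by apply: continuous_clamp => t; apply: cvgB; [exact: linc|exact: cvg_cst].
  have muc : continuous (fun t : R =>
      clamp (t * (#|` V|.*2.+2)%:R + #|` a|%:R - (#|` V|.*2.+1)%:R)).
    apply: continuous_clamp => t; apply: cvgB; last exact: cvg_cst.
    by apply: cvgD; [exact: linc|exact: cvg_cst].
  move=> t; apply: cvgD; first apply: cvgD.
  + apply: cvgM; last exact: cvg_cst.
    by apply: cvgB; [exact: cvg_cst|exact: lamc].
  + apply: cvgM; last exact: cvg_cst.
    by apply: cvgB; [exact: lamc|exact: muc].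
  + by apply: cvgM; [exact: muc|exact: cvg_cst].
- move=> a b; rewrite fpowersetE => /fsubset_leq_card aV.
  have aVR : #|` a|%:R <= #|` V|%:R :> R by rewrite ler_nat.
  have NE := natr_doubleS R #|` V|.
  have a0 : 0 <= #|` a|%:R :> R by [].
  rewrite /P /slide !clamp_eq0 ?NE; [|lra|lra].
  by rewrite !subr0 !mul0r mul1r !addr0.
- move=> a b; rewrite fpowersetE => /fsubset_leq_card aV.
  have aVR : #|` a|%:R <= #|` V|%:R :> R by rewrite ler_nat.
  have NE := natr_doubleS R #|` V|.
  have NE2 : #|` V|.*2.+2%:R = 2 * #|` V|%:R + 2 :> R.
    by rewrite -natr1 NE; lra.
  have a0 : 0 <= #|` a|%:R :> R by [].
  rewrite /P /slide !clamp_eq1 ?NE ?NE2; [|lra|lra].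
  by rewrite !subrr !mul0r mul1r !add0r.
Qed.

End Star.

(** * Discrete sets and subcomplexes *)

Section Inessential.
Variables (R : realType) (T : choiceType).
Implicit Types K L : simplicial_complex T.

(** Each component spanned by [Y] is a single vertex, so its realization is a
    point. *)
Lemma inessential_discrete K (Y : set T) : Y `<=` vertices K ->
  (forall u w, Y u -> Y w -> Defs.adjacent K u w -> u = w) ->
  inessential R K Y.
Proof.
move=> YK disc; split=> // v _.
set CD := @component_induced _ _ _ _; clearbody CD.
set C := component _ v in CD *.
have Cv c : faces C c -> (c `<=` [fset v])%fset.
  move=> [_ cv]; apply/fsubsetP => w /cv /=; rewrite inE => vw; apply/eqP.
  apply: esym; elim: vw => [a b [ab abY]|//|a b d _ -> _ //].
  by apply: disc ab; apply: abY; rewrite /= !inE eqxx ?orbT.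
have pt (x : realization R C) u : x u = (u == v)%:R.
  have [c /Cv cv /(simplex_sub cv)[_ x0]] := coordP x.
  rewrite big_seq_fset1 => xv; case: eqVneq => [->//|uv].
  by rewrite x0 // inE.
move=> x g _; exists (cst (realization_incl CD x)); split.
- by apply: continuous_subspaceT => p; exact: cvg_cst.
- move=> s _; split=> //; apply: realization_eq => u /=.
  by rewrite [LHS]pt [RHS]pt.
- by move=> t _; split; apply: realization_eq => u /=; rewrite [LHS]pt [RHS]pt.
Qed.

(** When all faces of [K] spanned by [Y] already lie in [L], a loop in a
    component spanned by [Y] in [K] is also one in [L], and a null-homotopy
    found there can be pushed forward to [K]. *)
Lemma inessential_sub K L (Y : set T) : faces L `<=` faces K ->
  faces (induced_subcomplex K Y) `<=` faces L ->
  inessential R L Y -> inessential R K Y.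
Proof.
move=> LK KYL [YL Yin]; split=> [u /YL /LK //|v Kv].
set CD := @component_induced _ _ _ _; clearbody CD.
have reachS M M' u w : faces M `<=` faces M' ->
    reachable M u w -> reachable M' u w.
  move=> MM'; elim=> [a b /MM'|a|a b c _ ab _ bc].
  - exact: rt_step.
  - exact: rt_refl.
  - exact: rt_trans ab bc.
have YKL : faces (induced_subcomplex K Y) `<=` faces (induced_subcomplex L Y).
  by move=> s Ks; split; [exact: KYL|case: Ks].
have CC : faces (component (induced_subcomplex K Y) v) `<=`
    faces (component (induced_subcomplex L Y) v).
  by move=> s [/YKL Ls sv]; split=> // w /sv; exact: reachS.
have DD : faces (component L v) `<=` faces (component K v).
  by move=> s [/LK Ks sv]; split=> // w /sv; exact: reachS.
move=> x g [gc g0 g1].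
have [|H [Hc H01 Ht]] := Yin v (YKL _ Kv) (realization_incl CC x)
    (realization_incl CC \o g).
  split; [|by rewrite /= g0|by rewrite /= g1].
  move=> s; apply: (continuous_comp (gc s)).
  exact: realization_incl_continuous.
exists (realization_incl DD \o H); split.
- move=> p; apply: (continuous_comp (Hc p)).
  exact: realization_incl_continuous.
- move=> s /H01[H0 H1]; rewrite /= H0 H1.
  by split; apply: realization_eq.
- move=> t /Ht[H0 H1]; rewrite /= H0 H1.
  by split; apply: realization_eq.
Qed.

End Inessential.

(** * Colouring the faces of a complex with few vertices *)

Section Colouring.
Variables (R : realType) (T : choiceType).
Implicit Types X : simplicial_complex T.

(** Some classes may be empty here, unlike the blocks of a partition; this keeps
    the induction simple. *)
Definition inessential_colouring X (n : nat) (f : {fset T} -> nat) : Prop :=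
  (forall s, faces X s -> (f s < n)%N) /\
  forall i, inessential R (barycentric X) [set s | faces X s /\ f s = i].

Lemma colouring_exists (n : nat) X (V : {fset T}) :
  faces X `<=` [set s | (s `<=` V)%fset] ->
  (#|` V| < ((n + 1) * (n + 2)) %/ 2)%N ->
  exists f, inessential_colouring X n f.
Proof.
elim: n X V => [|n IHn] X V XV Vn.
  have V0 : V = fset0 by apply/eqP; rewrite -cardfs_eq0; case: #|` V| Vn.
  have X0 s : ~ faces X s.
    move=> Xs; have := faces_neq0 Xs; have := XV _ Xs.
    by rewrite /= V0 fsubset0 => ->.
  exists (fun=> 0%N); split=> [s /X0 //|i].
  split=> [s [/X0 //]|v [_ /(_ v)]].
  by rewrite /= inE => /(_ (eqxx v)) [/X0].
have [[S XS Sn]|noS] := pselect (exists2 S, faces X S & (n.+1 < #|` S|)%N);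
    last first.
  exists (fun s => #|` s|.-1); split=> [s Xs|i].
    rewrite ltnS leqNgt; apply/negP => sn; apply: noS; exists s => //.
    by move: sn; case: #|` s|.
  apply: inessential_discrete => [s []|s t [Xs si] [Xt ti] [_ _]].
    by rewrite vertices_barycentric.
  have card_pos u : faces X u -> (0 < #|` u|)%N.
    by move=> /faces_neq0; rewrite cardfs_gt0.
  have st : #|` s| = #|` t|.
    by rewrite -(prednK (card_pos s Xs)) si -ti prednK // card_pos.
  move=> /(_ s t); rewrite !inE !eqxx orbT => /(_ isT isT)[sub|sub].
    by apply/eqP; rewrite eqEfcard sub st leqnn.
  by apply/esym/eqP; rewrite eqEfcard sub st leqnn.
pose X' := induced_subcomplex X [set v | v \notin S].
have X'E s : faces X s -> (s `&` S)%fset = fset0 -> faces X' s.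
  move=> Xs sS; split=> // v /= vs; apply/negP => vS.
  by have := in_fset0 v; rewrite -sS !inE vs vS.
have X'S s : faces X' s -> (s `&` S)%fset = fset0.
  case=> _ sS; apply/fsetP => v; rewrite !inE; apply/negP => /andP[/sS/=].
  by move/negbTE ->.
have [||f [fn fin]] := IHn X' (V `\` S)%fset.
- move=> s X's; rewrite /= fsubsetD (XV s); last by case: X's.
  by rewrite -fsetI_eq0 X'S /=.
- have SV := XV _ XS; rewrite cardfsDS //.
  have : (((n.+1 + 1) * (n.+1 + 2)) %/ 2 = n + 2 + (n + 1) * (n + 2) %/ 2)%N.
    by rewrite -divnMDl //; congr (_ %/ _)%N; lia.
  by have := fsubset_leq_card SV; move: Vn Sn; lia.
pose col s := if (s `&` S)%fset == fset0 then f s else n.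
exists col; split=> [s Xs|i].
  by rewrite /col; case: eqP => // sS; apply: ltnW; apply: fn; exact: X'E.
have [->|inn] := eqVneq i n.
  have -> : [set s | faces X s /\ col s = n]
      = [set s | faces X s /\ (s `&` S)%fset != fset0].
    apply/seteqP; split=> s /= [Xs]; rewrite /col; case: eqVneq => // sS fsn.
    by have := fn s (X'E s Xs sS); rewrite fsn ltnn.
  exact: inessential_star XV XS.
have -> : [set s | faces X s /\ col s = i]
    = [set s | faces X' s /\ f s = i].
  apply/seteqP; split=> s /=; rewrite /col.
    move=> [Xs]; case: eqVneq => [sS fs|_ ni]; first by split=> //; exact: X'E.
    by rewrite ni eqxx in inn.
  by move=> [X's fs]; split; [case: X's|rewrite X'S // eqxx].
apply: inessential_sub (fin i).
- by move=> c [c0 cX cc]; split=> // s /cX [].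
- by move=> c [[c0 cX cc] cY]; split=> // s /cY [].
Qed.

End Colouring.

Local Close Scope ring_scope.
Local Close Scope classical_set_scope.

Theorem theorem1p16 (R : realType) (T : choiceType) (X : simplicial_complex T)
    (n : nat) (hn : (1 <= n)%N)
    (hX : combinatorially_essential R n (barycentric X)) :
  (`I_(((n + 1) * (n + 2)) %/ 2) #<= vertices X)%card.
Proof.
apply: contrapT => small; apply: hX.
have finV : finite_set (vertices X).
  apply: contrapT => /infiniteP natV; apply: small.
  by apply: card_le_trans natV; exact: subset_card_le.
pose V := fset_set (vertices X).
have XV : (faces X `<=` [set s | (s `<=` V)%fset])%classic.
  move=> s Xs; apply/fsubsetP => v vs; rewrite in_fset_set // inE /vertices /=.
  apply: faces_sub Xs _ _; first by rewrite fsub1set.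
  by apply/fset0Pn; exists v; rewrite inE.
have Vn : (#|` V| < ((n + 1) * (n + 2)) %/ 2)%N.
  rewrite ltnNge; apply/negP => nV; apply: small.
  have VE : (vertices X #= `I_(#|` V|))%card.
    by rewrite -{1}(fset_setK finV); exact/card_eq_fsetP.
  by rewrite (card_le_eqr VE) card_le_II.
have [f [fn fin]] := @colouring_exists R T n X V XV Vn.
pose F i := [set s | faces X s /\ f s = i]%classic.
(* The blocks of a partition are nonempty, so only the colours in use are kept
   and they are renumbered by their position in this list. *)
pose used := [seq i <- iota 0 n | `[< (F i !=set0)%classic >]].
exists (size used), (fun k => F (nth 0%N used k)); split.
- by rewrite size_filter (leq_trans (count_size _ _)) // size_iota.
- rewrite vertices_barycentric; split.
  + apply/seteqP; split=> [s [k _ [Xs _]]|s Xs]; first exact: Xs.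
    have su : f s \in used.
      rewrite mem_filter mem_iota leq0n add0n fn // !andbT; apply/asboolP.
      by exists s.
    exists (index (f s) used); first by rewrite /= index_mem.
    by rewrite nth_index.
  + move=> k l /= kn ln [s [[_ sk] [_ sl]]]; apply/eqP.
    by rewrite -(nth_uniq 0%N kn ln) -?sk ?sl // filter_uniq ?iota_uniq.
  + move=> k /= kn; have := mem_nth 0%N kn.
    by rewrite mem_filter => /andP[/asboolP].
- by move=> k _; exact: fin.
Qed.
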